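(* Let $f_0 \in R_{A_0}$ be such that $N_{f_0}$ has full rank, i.e. $\operatorname{rank}(N_{f_0}) = \gamma$, let $B \subset E_0$ be of cardinality $\gamma$ with $N_{f_0,B}$ invertible, let $g \in R_{A_0}$, and let $M_g = N_{g,B}\, N_{f_0,B}^{-1}$. (1) For each solution $\zeta \in \mathbb{C}^n$ of $\mathcal{F}$ such that $\zeta^D \neq 0$, the matrix $M_g$ has a left eigenvector $v_\zeta$ such that $v_\zeta \cdot \mathrm{Coker}(\mathcal{F},\mathbf{E};D) = \zeta^D$, and the corresponding eigenvalue is $\frac{g}{f_0}(\zeta) = g(\zeta)/f_0(\zeta)$. (2) Conversely, if $v$ is a left eigenvector of $M_g$ such that $v \cdot \mathrm{Coker}(\mathcal{F},\mathbf{E};D)$ is proportional to $\zeta^D \neq 0$ for some $\zeta \in \mathbb{C}^n$ such that $\zeta^{E_i} \neq 0$ for all $i \in \{1,\dots,s\}$, then $\zeta$ is a solution of $\mathcal{F}$. Moreover, the corresponding eigenvalue of $M_g$ is $\frac{g}{f_0}(\zeta)$.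
   Context: Let $R=\mathbb{C}[x_1,\dots,x_n]$ and $\mathbb{N}=\{0,1,2,\dots\}$. For a finite $E\subset\mathbb{N}^n$ let $R_E=\bigoplus_{\alpha\in E}\mathbb{C}\,x^\alpha$, and for $\zeta\in\mathbb{C}^n$ let $\zeta^E=(\zeta^\alpha)_{\alpha\in E}$, a row vector (with $0^0=1$). Let $\mathcal{F}=(f_1,\dots,f_s)\in R^s$, $s\ge n$, $f_i=\sum_\alpha c_{i,\alpha}x^\alpha$, with supports $A_i=\{\alpha: c_{i,\alpha}\ne0\}$. A solution of $\mathcal{F}$ is a point $\zeta\in\mathbb{C}^n$ with $f_i(\zeta)=0$ for all $i$. Let $\mathbf{E}=(E_1,\dots,E_s)$ and $D$ be finite sets of exponents in $\mathbb{N}^n$ with $A_i+E_i\subset D$ (Minkowski sum) for $i=1,\dots,s$. The Macaulay matrix $\mathrm{M}(\mathcal{F},\mathbf{E};D)$ has rows indexed by $\alpha\in D$, columns indexed by pairs $(i,\beta)$ with $1\le i\le s$, $\beta\in E_i$, and entries $c_{i,\alpha-\beta}$ (zero if $\alpha-\beta\notin\mathbb{N}^n$). It represents the map $(g_1,\dots,g_s)\mapsto\sum_i g_if_i$ from $R_{E_1}\times\dots\times R_{E_s}$ to $R_D$. Let $\gamma=\mathrm{HF}(\mathcal{F},\mathbf{E};D):=\#D-\operatorname{rank}\mathrm{M}(\mathcal{F},\mathbf{E};D)$, and let $\mathrm{Coker}(\mathcal{F},\mathbf{E};D)\in\mathbb{C}^{\gamma\times\#D}$ be a fixed matrix of rank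 $\gamma$ with $\mathrm{Coker}(\mathcal{F},\mathbf{E};D)\cdot\mathrm{M}(\mathcal{F},\mathbf{E};D)=0$. Let $A_0,E_0\subset\mathbb{N}^n$ be finite with $A_0+E_0\subset D$. For $g\in R_{A_0}$ put $N_g=\mathrm{Coker}(\mathcal{F},\mathbf{E};D)\cdot\mathrm{M}(g,E_0;D)\in\mathbb{C}^{\gamma\times\#E_0}$, where $\mathrm{M}(g,E_0;D)$ is the Macaulay matrix of the single polynomial $g$ with exponent set $E_0$. The columns of $N_g$ are indexed by $E_0$; for $B\subset E_0$, $N_{g,B}$ denotes the submatrix of columns indexed by $B$. A left eigenvector of a matrix $M$ with eigenvalue $\lambda$ is a non-zero row vector $v$ with $v\cdot M=\lambda v$. *)

(* Defs.v *)
From mathcomp Require Export all_boot all_order all_algebra.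
From mathcomp Require Export finmap.
From mathcomp Require Export mpoly.
From mathcomp Require Export reals.
From mathcomp Require Export complex.

Set Implicit Arguments.
Unset Strict Implicit.
Unset Printing Implicit Defensive.

Export GRing.Theory.

Local Open Scope fset_scope.
Local Open Scope ring_scope.

(* Rows and columns labelled by a finite type T are encoded by ordinals
   i : 'I_#|T| through the enumeration [enum_val] of T. *)

Definition minkowski (n : nat) (A E : {fset 'X_{1..n}}) : {fset 'X_{1..n}} :=
  [fset (a + b)%MM | a in A, b in E].

Definition supp (n : nat) (K : nzRingType) (f : {mpoly K[n]}) :
    {fset 'X_{1..n}} :=
  [fset a | a in msupp f].

Definition power_row (n : nat) (K : comNzRingType) (z : 'I_n -> K)
    (E : {fset 'X_{1..n}}) : 'rV[K]_#|{: E}| :=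
  \row_j \prod_(k < n) z k ^+ (val (enum_val j) : 'X_{1..n}) k.

(* The subtraction of multinomials is truncated, hence the test b <= a. *)
Definition shifted_coef (n : nat) (K : nzRingType) (f : {mpoly K[n]})
    (a b : 'X_{1..n}) : K :=
  if (b <= a)%MM then f@_(a - b) else 0.

Definition macaulay (n s : nat) (K : nzRingType) (F : 'I_s -> {mpoly K[n]})
    (E : 'I_s -> {fset 'X_{1..n}}) (D : {fset 'X_{1..n}}) :
    'M[K]_(#|{: D}|, #|{: {i : 'I_s & E i}}|) :=
  \matrix_(r, c) shifted_coef (F (tag (enum_val c)))
                   (val (enum_val r)) (val (tagged (enum_val c))).

(* The case s = 1, with columns labelled by E instead of pairs (1, b). *)
Definition macaulay1 (n : nat) (K : nzRingType) (g : {mpoly K[n]})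
    (E D : {fset 'X_{1..n}}) : 'M[K]_(#|{: D}|, #|{: E}|) :=
  \matrix_(r, c) shifted_coef g (val (enum_val r)) (val (enum_val c)).

Definition HF (n s : nat) (K : fieldType) (F : 'I_s -> {mpoly K[n]})
    (E : 'I_s -> {fset 'X_{1..n}}) (D : {fset 'X_{1..n}}) : nat :=
  (#|` D| - \rank (macaulay F E D))%N.

Definition is_coker (n s : nat) (K : fieldType) (F : 'I_s -> {mpoly K[n]})
    (E : 'I_s -> {fset 'X_{1..n}}) (D : {fset 'X_{1..n}})
    (Co : 'M[K]_(HF F E D, #|{: D}|)) : Prop :=
  \rank Co = HF F E D /\ Co *m macaulay F E D = 0.

Definition Nmx (n m : nat) (K : nzRingType) (D : {fset 'X_{1..n}})
    (Co : 'M[K]_(m, #|{: D}|)) (E0 : {fset 'X_{1..n}}) (g : {mpoly K[n]}) :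
    'M[K]_(m, #|{: E0}|) :=
  Co *m macaulay1 g E0 D.

(* [cB] is used to see the columns labelled by B as those of a square matrix. *)
Definition colsB (n m : nat) (K : nzRingType) (E0 B : {fset 'X_{1..n}})
    (sB : B `<=` E0) (cB : #|` B| = m) (N : 'M[K]_(m, #|{: E0}|)) : 'M[K]_m :=
  colsub (fun k : 'I_m =>
    enum_rank (fincl sB (enum_val (cast_ord (etrans (esym cB) (cardfE B)) k)))) N.

Definition multmx (n m : nat) (K : fieldType) (D : {fset 'X_{1..n}})
    (Co : 'M[K]_(m, #|{: D}|)) (E0 B : {fset 'X_{1..n}})
    (sB : B `<=` E0) (cB : #|` B| = m) (f0 g : {mpoly K[n]}) : 'M[K]_m :=
  colsB sB cB (Nmx Co E0 g) *m invmx (colsB sB cB (Nmx Co E0 f0)).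

Definition solution (n s : nat) (K : comNzRingType) (F : 'I_s -> {mpoly K[n]})
    (z : 'I_n -> K) : Prop :=
  forall i, (F i).@[z] = 0.

Definition left_eigenvector (m : nat) (K : fieldType) (M : 'M[K]_m)
    (v : 'rV[K]_m) (lambda : K) : Prop :=
  v != 0 /\ v *m M = lambda *: v.

(* Main.v *)
(* Multiplying by [z^D] on the left evaluates the polynomials represented by
   the columns of a Macaulay matrix: the column of [x^b * f] is sent to
   [f(z) * z^b]. Hence [z] is a solution iff [z^D] is in the left kernel of
   [M(F, E; D)] (given that no [z^E_i] vanishes, for the converse), and this left
   kernel is the row space of the cokernel matrix. When [v *m Co = c *: z^D],
   both [v *m N_{g,B}] and [v *m N_{f0,B}] are multiples of [z^B], with
   coefficients [c g(z)] and [c f0(z)]; the latter is non-zero since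
   [N_{f0,B}] is invertible, which gives the eigenvalue [g(z) / f0(z)]. *)

Require Import Defs.

Local Open Scope fset_scope.
Local Open Scope ring_scope.

Set Implicit Arguments.
Unset Strict Implicit.
Unset Printing Implicit Defensive.

Definition mon_eval (n : nat) (K : comNzRingType) (z : 'I_n -> K)
    (a : 'X_{1..n}) : K := \prod_(k < n) z k ^+ a k.

Lemma mon_evalD (n : nat) (K : comNzRingType) (z : 'I_n -> K) (a b : 'X_{1..n}) :
  mon_eval z (a + b)%MM = mon_eval z a * mon_eval z b.
Proof.
by rewrite -big_split /=; apply: eq_bigr => k _; rewrite mnmDE exprD.
Qed.

Lemma minkowski_sub (n : nat) (A A' E : {fset 'X_{1..n}}) :
  A `<=` A' -> minkowski A E `<=` minkowski A' E.
Proof.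
move=> sA; apply/fsubsetP => x /imfset2P [a aA [b bE ->]].
by apply: in_imfset2 => //=; apply: (fsubsetP sA).
Qed.

(** The coefficients involved are those of [x^b * f], whose exponents all lie in [D] by the
    inclusion hypothesis, so that summing over [D] loses no term of its value at [z]. *)
Lemma sum_shifted_coef (n : nat) (K : comNzRingType) (f : {mpoly K[n]})
    (E D : {fset 'X_{1..n}}) (z : 'I_n -> K) (b : 'X_{1..n}) :
  minkowski (supp f) E `<=` D -> b \in E ->
  \sum_(a <- D) mon_eval z a * shifted_coef f a b = f.@[z] * mon_eval z b.
Proof.
move=> sD bE; pose s := [seq (m + b)%MM | m <- msupp f].
have sE a : shifted_coef f a b != 0 -> a \in s.
  rewrite /shifted_coef; case: ifP => [le_ba nz|_]; last by rewrite eqxx.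
  by apply/mapP; exists (a - b)%MM; rewrite ?submK // mcoeff_msupp.
rewrite (bigID (mem s)) /= [X in _ + X]big1 ?addr0; last first.
  by move=> a /(contraNeq (@sE a)) ->; rewrite mulr0.
(* Translation by [b] is injective, so [s] has no repetition and enumerates exactly the part of [D]
   that contributes. *)
rewrite -big_filter (perm_big s) /=; last first.
  apply: uniq_perm.
  - by rewrite filter_uniq // fset_uniq.
  - by rewrite map_inj_uniq ?msupp_uniq // => m1 m2 /addIm.
  move=> a; rewrite mem_filter; case: (boolP (a \in s)) => //=.
  case/mapP=> m mf ->; apply: (fsubsetP sD); apply: in_imfset2 => //=.
  by rewrite /supp in_fset.
rewrite big_map mevalE mulr_suml; apply: eq_bigr => m _.
by rewrite /shifted_coef lem_addl addmK mon_evalD mulrC mulrA.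
Qed.

Lemma sum_enum_fset (T : choiceType) (V : nmodType) (D : {fset T}) (G : T -> V) :
  \sum_(r < #|{: D}|) G (val (enum_val r)) = \sum_(a <- D) G a.
Proof.
by rewrite big_seq_fsetE /= (big_enum_val (fun x : D => G (val x))).
Qed.

Section Evaluation.

Variables (n : nat) (K : comNzRingType) (z : 'I_n -> K) (D : {fset 'X_{1..n}}).

Lemma power_row_macaulay1 (f : {mpoly K[n]}) (E : {fset 'X_{1..n}}) :
  minkowski (supp f) E `<=` D ->
  power_row z D *m macaulay1 f E D = f.@[z] *: power_row z E.
Proof.
move=> sD; apply/rowP => j; rewrite !mxE.
rewrite -(sum_shifted_coef z sD (valP (enum_val j))) -sum_enum_fset.
by apply: eq_bigr => r _; rewrite !mxE.
Qed.

Lemma power_row_macaulay (s : nat) (F : 'I_s -> {mpoly K[n]})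
    (E : 'I_s -> {fset 'X_{1..n}}) c :
  (forall i, minkowski (supp (F i)) (E i) `<=` D) ->
  (power_row z D *m macaulay F E D) 0 c =
  (F (tag (enum_val c))).@[z] * mon_eval z (val (tagged (enum_val c))).
Proof.
move=> sD; rewrite !mxE.
rewrite -(sum_shifted_coef z (sD _) (valP (tagged (enum_val c)))) -sum_enum_fset.
by apply: eq_bigr => r _; rewrite !mxE.
Qed.

Lemma solution_power_row (s : nat) (F : 'I_s -> {mpoly K[n]})
    (E : 'I_s -> {fset 'X_{1..n}}) :
  (forall i, minkowski (supp (F i)) (E i) `<=` D) ->
  solution F z -> power_row z D *m macaulay F E D = 0.
Proof.
by move=> sD Fz; apply/rowP => c; rewrite power_row_macaulay // Fz mul0r mxE.
Qed.

End Evaluation.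

Lemma power_row_solution (n s : nat) (K : fieldType) (z : 'I_n -> K)
    (F : 'I_s -> {mpoly K[n]}) (E : 'I_s -> {fset 'X_{1..n}})
    (D : {fset 'X_{1..n}}) :
  (forall i, minkowski (supp (F i)) (E i) `<=` D) ->
  (forall i, power_row z (E i) != 0) ->
  power_row z D *m macaulay F E D = 0 -> solution F z.
Proof.
move=> sD nzE Mz i; have /rV0Pn [j] := nzE i; rewrite mxE => nzj.
(* The column [(i, b)], where [b] in [E i] is chosen with [z^b] non-zero: its entry [f_i(z) * z^b]
   vanishes only if [f_i(z)] does. *)
pose t : {i : 'I_s & E i} := Tagged (fun i => E i) (enum_val j).
have /eqP := power_row_macaulay z (enum_rank t) sD.
rewrite Mz enum_rankK mxE eq_sym mulf_eq0 => /orP [/eqP //|].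
by rewrite (negPf nzj : (mon_eval z _ == 0) = false).
Qed.

Section Cokernel.

Variables (n s : nat) (K : fieldType) (F : 'I_s -> {mpoly K[n]}).
Variables (E : 'I_s -> {fset 'X_{1..n}}) (D : {fset 'X_{1..n}}).
Variables (Co : 'M[K]_(HF F E D, #|{: D}|)) (hCo : is_coker Co).

Lemma coker_row_free : row_free Co.
Proof. by case: hCo => rk _; rewrite /row_free rk. Qed.

(** The rows of [Co] lie in the left kernel of the Macaulay matrix, and [HF] is the dimension of
    that kernel, so the inclusion of row spaces is an equality. *)
Lemma coker_kermx (u : 'rV[K]_#|{: D}|) :
  u *m macaulay F E D = 0 -> exists v, v *m Co = u.
Proof.
case: hCo => rk CoM uM.
have sub : (Co <= kermx (macaulay F E D))%MS by apply/sub_kermxP.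
have eqr : \rank Co = \rank (kermx (macaulay F E D)).
  by rewrite rk mxrank_ker /HF cardfE.
have : (u <= Co)%MS.
  apply: (@submx_trans _ _ _ _ _ _ (kermx (macaulay F E D))).
    exact/sub_kermxP.
  by rewrite -(geq_leqif (mxrank_leqif_sup sub)) eqr.
by case/submxP => v ->; exists v.
Qed.

End Cokernel.

Lemma Nmx_power_row (n m : nat) (K : comNzRingType) (D : {fset 'X_{1..n}})
    (Co : 'M[K]_(m, #|{: D}|)) (E0 : {fset 'X_{1..n}}) (g : {mpoly K[n]})
    (z : 'I_n -> K) (v : 'rV[K]_m) (c : K) :
  minkowski (supp g) E0 `<=` D -> v *m Co = c *: power_row z D ->
  v *m Nmx Co E0 g = (c * g.@[z]) *: power_row z E0.
Proof.
by move=> sD vCo; rewrite mulmxA vCo -scalemxAl power_row_macaulay1 ?scalerA.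
Qed.

(** Used with [w] the row [z^E0], [a = c f0(z)] and [b = c g(z)]. If [a] were zero, the invertible
    block of [f0] would kill the non-zero [v]. *)
Lemma multmx_left_eigenvector (n m : nat) (K : fieldType)
    (D : {fset 'X_{1..n}}) (Co : 'M[K]_(m, #|{: D}|)) (E0 B : {fset 'X_{1..n}})
    (sB : B `<=` E0) (cB : #|` B| = m) (f0 g : {mpoly K[n]})
    (v : 'rV[K]_m) (w : 'rV[K]_#|{: E0}|) (a b : K) :
  colsB sB cB (Nmx Co E0 f0) \in unitmx -> v != 0 ->
  v *m Nmx Co E0 f0 = a *: w -> v *m Nmx Co E0 g = b *: w ->
  a != 0 /\ left_eigenvector (multmx Co sB cB f0 g) v (b / a).
Proof.
move=> uB nz_v vf vg; set M := colsB _ _ _ in uB.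
have colsE N c : v *m N = c *: w ->
    v *m colsB sB cB N = c *: colsub (fun k => enum_rank (fincl sB (enum_val
      (cast_ord (etrans (esym cB) (cardfE B)) k)))) w.
  by move=> vN; rewrite /colsB mulmx_colsub vN; apply/rowP => j; rewrite !mxE.
move: (colsE _ _ vf) (colsE _ _ vg); set wB := colsub _ _ => vM vMg.
have nz_a : a != 0.
  apply: contraNneq nz_v => a0.
  by rewrite -(mulmxK uB v) vM a0 scale0r mul0mx.
split=> //; split=> //.
(* Replacing [wB] by [a^-1 *: (v *m M)] lets [M] cancel against its inverse. *)
rewrite /multmx mulmxA vMg -[wB](scalerK nz_a) -vM scalerA.
by rewrite -scalemxAl mulmxK.
Qed.

Theorem theorem2p1 (R : realType) (n s : nat) (hs : (n <= s)%N)
  (F : 'I_s -> {mpoly (R[i])[n]})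
  (E : 'I_s -> {fset 'X_{1..n}}) (D : {fset 'X_{1..n}})
  (hD : forall i, minkowski (supp (F i)) (E i) `<=` D)
  (Co : 'M[R[i]]_(HF F E D, #|{: D}|)) (hCo : is_coker Co)
  (A0 E0 : {fset 'X_{1..n}}) (hD0 : minkowski A0 E0 `<=` D)
  (f0 : {mpoly (R[i])[n]}) (hf0 : supp f0 `<=` A0)
  (hrank : \rank (Nmx Co E0 f0) = HF F E D)
  (B : {fset 'X_{1..n}}) (sB : B `<=` E0) (cB : #|` B| = HF F E D)
  (hB : colsB sB cB (Nmx Co E0 f0) \in unitmx)
  (g : {mpoly (R[i])[n]}) (hg : supp g `<=` A0) :
  (forall z : 'I_n -> R[i],
     solution F z -> power_row z D != 0 ->
     f0.@[z] != 0 /\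
     exists v : 'rV[R[i]]_(HF F E D),
       left_eigenvector (multmx Co sB cB f0 g) v (g.@[z] / f0.@[z]) /\
       v *m Co = power_row z D)
  /\
  (forall (v : 'rV[R[i]]_(HF F E D)) (lambda : R[i]) (z : 'I_n -> R[i]),
     left_eigenvector (multmx Co sB cB f0 g) v lambda ->
     power_row z D != 0 ->
     (exists c : R[i], v *m Co = c *: power_row z D) ->
     (forall i, power_row z (E i) != 0) ->
     solution F z /\ f0.@[z] != 0 /\ lambda = g.@[z] / f0.@[z]).
Proof.
have sf0 := fsubset_trans (minkowski_sub E0 hf0) hD0.
have sg := fsubset_trans (minkowski_sub E0 hg) hD0.
(* Shared by both directions: the first takes [c = 1], the second the given proportionality factor,
   which cancels in the quotient. *)
have eigen v c z : v != 0 -> c != 0 -> v *m Co = c *: power_row z D ->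
    f0.@[z] != 0 /\
    left_eigenvector (multmx Co sB cB f0 g) v (g.@[z] / f0.@[z]).
  move=> nz_v nz_c vCo.
  have [] := multmx_left_eigenvector hB nz_v
    (Nmx_power_row sf0 vCo) (Nmx_power_row sg vCo).
  by rewrite mulf_eq0 (negPf nz_c) -mulf_div divff ?mul1r.
split=> [z Fz nz_zD | v lambda z [nz_v vM] nz_zD [c vCo] nz_zE].
  have [v vCo] := coker_kermx hCo (solution_power_row hD Fz).
  have nz_v : v != 0.
    by apply: contraNneq nz_zD => v0; rewrite -vCo v0 mul0mx.
  have [||nz_f0 vM] := eigen v 1 z nz_v; rewrite ?oner_eq0 ?scale1r //.
  by split=> //; exists v.
have nz_c : c != 0.
  (* The rows of [Co] are independent, so [v *m Co = 0] would force [v = 0]. *)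
  apply: contraNneq nz_v => c0; apply/eqP/(row_free_inj (coker_row_free hCo)).
  by rewrite vCo c0 scale0r mul0mx.
have [nz_f0 [_ vM']] := eigen v c z nz_v nz_c vCo.
split.
  apply: (power_row_solution hD nz_zE); apply: (scalerI nz_c).
  by rewrite scalemxAl -vCo -mulmxA (proj2 hCo) mulmx0 scaler0.
split=> //; apply/eqP; rewrite -subr_eq0.
(* Both scalars are eigenvalues for the same non-zero [v], hence equal. *)
have : (lambda - g.@[z] / f0.@[z]) *: v = 0 by rewrite scalerBl -vM -vM' subrr.
by move/eqP; rewrite scaler_eq0 (negPf nz_v) orbF.
Qed.
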